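(* Let $n\geq 3$ and $\mathbf{q}=(q_0,\dots,q_{n-1}),\mathbf{p}=(p_0,\dots,p_{n-1})\in(\Bbbk^\times)^n$. Then $A_n(\mathbf{q})\cong A_n(\mathbf{p})$ if and only if there exist $\alpha_0,\dots,\alpha_{n-1}\in\Bbbk^\times$ and $0\le k<n$ such that either (1) $p_i=\frac{\alpha_{i+k-1}}{\alpha_{i+k}}q_{i+k}$ for all $0\le i<n$, or (2) $p_i=\frac{\alpha_{n-i-k}}{\alpha_{n-i-k-1}}q_{n-i-k}^{-1}$ for all $0\le i<n$ (indices taken modulo $n$).
   Context: $\Bbbk$ is an algebraically closed field of characteristic zero. Paths are written left to right ($xy$ means $x$ then $y$). For $\mathbf{q}\in(\Bbbk^\times)^n$, $A_n(\mathbf{q})=\Bbbk Q/(a_ia_i^*-q_ia_{i-1}^*a_{i-1},\ i=0,\dots,n-1)$, where $Q$ has vertices $e_0,\dots,e_{n-1}$ and arrows $a_i:e_i\to e_{i+1}$ and $a_i^*:e_{i+1}\to e_i$ for $i=0,\dots,n-1$, indices modulo $n$. *)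

(* Defs.v *)
From HB Require Import structures.
From mathcomp Require Import all_boot all_algebra.
From mathcomp Require Import freeg.

Set Implicit Arguments.
Unset Strict Implicit.
Unset Printing Implicit Defensive.

Import GRing.Theory Num.Theory.
Local Open Scope ring_scope.

(* The quiver Q: vertices e_0..e_{n-1} = 'I_n; arrows are pairs (i, b):    *)
(*   (i, false) = a_i   : e_i     -> e_{i+1}                               *)
(*   (i, true)  = a_i^* : e_{i+1} -> e_i          (indices modulo n)       *)
Definition arrow (n : nat) := ('I_n * bool)%type.

Definition asrc n (a : arrow n) : 'I_n := if a.2 then ordS a.1 else a.1.
Definition atgt n (a : arrow n) : 'I_n := if a.2 then a.1 else ordS a.1.

(* [valid v s] : the sequence of arrows s is a path starting at vertex v,  *)
(* arrows composed left to right (xy = x then y).                          *)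
Fixpoint valid n (v : 'I_n) (s : seq (arrow n)) : bool :=
  if s is a :: s' then (asrc a == v) && valid (atgt a) s' else true.

Fixpoint pend n (v : 'I_n) (s : seq (arrow n)) : 'I_n :=
  if s is a :: s' then pend (atgt a) s' else v.

(* A path of Q: a start vertex together with a composable arrow sequence; *)
(* the trivial path at v is (v, [::]).                                     *)
Definition qpath n := {p : 'I_n * seq (arrow n) | valid p.1 p.2}.

Definition qstart n (p : qpath n) : 'I_n := (val p).1.
Definition qend n (p : qpath n) : 'I_n := pend (val p).1 (val p).2.

Definition pathalg (k : fieldType) (n : nat) := {freeg (qpath n) / k}.

Definition pgen (k : fieldType) n (p : qpath n) : pathalg k n := [freeg [:: (1, p)]].

Definition pmul (k : fieldType) n (p q : qpath n) : pathalg k n :=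
  if qend p == qstart q then
    match insub ((val p).1, (val p).2 ++ (val q).2) with
    | Some r => pgen k r
    | None => 0
    end
  else 0.

Definition mulQ (k : fieldType) n (x y : pathalg k n) : pathalg k n :=
  fglift (fun p => fglift (fun q => pmul k p q) y) x.

Lemma valid_triv n (v : 'I_n) : valid v [::]. Proof. by []. Qed.

Lemma valid_a n (i : 'I_n) : valid i [:: (i, false)].
Proof. by rewrite /= /asrc /= eqxx. Qed.

Lemma valid_astar n (i : 'I_n) : valid (ordS i) [:: (i, true)].
Proof. by rewrite /= /asrc /= eqxx. Qed.

Definition evert (k : fieldType) n (v : 'I_n) : pathalg k n :=
  pgen k (exist (fun p : 'I_n * seq (arrow n) => valid p.1 p.2) (v, [::]) (valid_triv v)).
Definition arr_a (k : fieldType) n (i : 'I_n) : pathalg k n :=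
  pgen k (exist (fun p : 'I_n * seq (arrow n) => valid p.1 p.2) (i, [:: (i, false)]) (valid_a i)).
Definition arr_astar (k : fieldType) n (i : 'I_n) : pathalg k n :=
  pgen k (exist (fun p : 'I_n * seq (arrow n) => valid p.1 p.2) (ordS i, [:: (i, true)]) (valid_astar i)).

Definition oneQ (k : fieldType) n : pathalg k n := \sum_(v < n) evert k v.

Definition relq (k : fieldType) n (q : 'I_n -> k) (i : 'I_n) : pathalg k n :=
  mulQ (arr_a k i) (arr_astar k i)
  - q i *: mulQ (arr_astar k (ord_pred i)) (arr_a k (ord_pred i)).

Definition idealq (k : fieldType) n (q : 'I_n -> k) (x : pathalg k n) : Prop :=
  exists s : seq (pathalg k n * 'I_n * pathalg k n),
    x = \sum_(t <- s) mulQ (mulQ t.1.1 (relq q t.1.2)) t.2.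

(* A_n(q) = kQ / idealq q.  [An_iso q p] : there is a k-algebra isomorphism *)
(* A_n(q) -> A_n(p), written on representatives: a map f : kQ -> kQ which  *)
(* is well defined modulo the ideals, k-linear, multiplicative and unital  *)
(* modulo idealq p, injective and surjective on the quotients.             *)
Definition An_iso (k : fieldType) n (q p : 'I_n -> k) : Prop :=
  exists f : pathalg k n -> pathalg k n,
    (forall x y, idealq q (x - y) -> idealq p (f x - f y)) /\
    (forall x y, idealq p (f (x + y) - (f x + f y))) /\
    (forall (c : k) x, idealq p (f (c *: x) - c *: f x)) /\
    (forall x y, idealq p (f (mulQ x y) - mulQ (f x) (f y))) /\
    idealq p (f (oneQ k n) - oneQ k n) /\
    (forall x y, idealq p (f x - f y) -> idealq q (x - y)) /\
    (forall y, exists x, idealq p (f x - y)).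

(* Index arithmetic modulo n: [zmodI w z] is z mod n as an element of 'I_n *)
(* (the witness w : 'I_n only serves to show n > 0).                       *)
Lemma zmodI_subproof n (w : 'I_n) (z : int) : (absz (z %% n%:Z)%Z < n)%N.
Proof.
have n0 : (0 < n)%N by apply: leq_ltn_trans (ltn_ord w).
have h0 : (0 <= (z %% n%:Z)%Z). by apply: modz_ge0; rewrite eqz_nat -lt0n.
have h1 : ((z %% n%:Z)%Z < n%:Z) by apply: ltz_pmod; rewrite ltz_nat.
by rewrite -ltz_nat gez0_abs.
Qed.

Definition zmodI n (w : 'I_n) (z : int) : 'I_n := Ordinal (zmodI_subproof w z).

(* Main.v *)
Require Import Defs.
From HB Require Import structures.
From mathcomp Require Import all_boot all_algebra.
From mathcomp Require Import freeg.
From mathcomp Require Import ring zify.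
Import GRing.Theory.
Local Open Scope ring_scope.

Set Implicit Arguments.
Unset Strict Implicit.
Unset Printing Implicit Defensive.

(* Necessity.  No arrow is a loop, so the characters of the path algebra are
   exactly the coefficients of the trivial paths; an isomorphism f therefore
   permutes the vertices.  Composed with f, the coefficient of an arrow
   [u -> v] becomes a derivation twisted by two vertex characters, and by
   surjectivity it is nonzero on some arrow between the corresponding
   vertices: the vertex permutation is an automorphism of the n-cycle, hence
   a rotation or a reflection.  In degree two the functional
   [p_j * coef (a_j a_j^* ) + coef (a_{j-1}^* a_{j-1})] kills the ideal of
   A_n(p); evaluating it on the image of the relation of A_n(q) at the
   vertex corresponding to j gives the formula for p_j.

   Sufficiency.  A rotation or reflection of the quiver, with the arrows
   rescaled by alpha, carries each relation of A_n(q) to a nonzero multiple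
   of a relation of A_n(p). *)

(** * Linear extension from a basis *)

Section FreeModule.
Variables (R : nzRingType) (K : choiceType) (M : lmodType R).

Lemma fgliftZ (g : K -> M) c (x : {freeg K / R}) :
  fglift g (c *: x) = c *: fglift g x.
Proof.
pose fgl_is_additive := GRing.isZmodMorphism.Build _ _ _ (lift_is_additive g).
pose fgl : {additive {freeg K / R} -> M} := HB.pack (fglift g) fgl_is_additive.
rewrite -[x in RHS]freeg_sumE -[LHS]/(fgl _) -[RHS]/(c *: fgl _).
rewrite -[c *: x]/(fgscale c x) /fgscale !raddf_sum.
by apply: eq_bigr => z _; rewrite /= !liftU scalerA.
Qed.

Lemma fglift_linear (g : K -> M) : linear (fglift g).
Proof.
move=> c x y; rewrite -{1}[y]opprK (lift_is_additive g) fgliftZ; congr (_ + _).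
by rewrite -[- y]scaleN1r fgliftZ scaleN1r opprK.
Qed.

HB.instance Definition _ (g : K -> M) :=
  GRing.isLinear.Build R {freeg K / R} M *:%R (fglift g) (fglift_linear g).

Lemma freegU_scale c (x : K) : << c *g x >> = c *: << x >> :> {freeg K / R}.
Proof. by apply/eqP/freeg_eqP => z; rewrite coeffZ !coeffU mul1r. Qed.

Lemma freeg_linear_eq (F G : {freeg K / R} -> M) :
  linear F -> linear G -> (forall z, F << z >> = G << z >>) -> F =1 G.
Proof.
move=> linF linG eqFG.
pose F' : {linear _ -> _} := HB.pack F (GRing.isLinear.Build _ _ _ _ F linF).
pose G' : {linear _ -> _} := HB.pack G (GRing.isLinear.Build _ _ _ _ G linG).
move=> x; rewrite -[LHS]/(F' x) -[RHS]/(G' x) -[x]freeg_sumE !linear_sum.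
by apply: eq_bigr => z _; rewrite freegU_scale !linearZ /= eqFG.
Qed.

End FreeModule.

(** * Bilinearity of the path algebra product and its values on paths *)

Section PathAlgebra.
Variables (k : fieldType) (n : nat).
Implicit Types (v w : 'I_n) (s t : seq (arrow n)) (a b : arrow n).
Implicit Types (x y : pathalg k n).

Lemma valid_cat v s t : valid v (s ++ t) = valid v s && valid (pend v s) t.
Proof. by elim: s v => //= a s IHs v; rewrite IHs andbA. Qed.

(* [0] when [r] is not a path. *)
Definition path_elt (r : 'I_n * seq (arrow n)) : pathalg k n :=
  oapp (@pgen k n) 0 (insub r).

Lemma pgenE (r : qpath n) : pgen k r = path_elt (val r).
Proof. by rewrite /path_elt valK. Qed.

Lemma path_elt_invalid v s : ~~ valid v s -> path_elt (v, s) = 0.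
Proof. by move=> nv; rewrite /path_elt insubN. Qed.

Lemma evertE v : evert k v = path_elt (v, [::]).
Proof. exact: pgenE. Qed.

Definition arr a : pathalg k n := path_elt (asrc a, [:: a]).

Lemma arr_aE i : arr_a k i = arr (i, false).
Proof. exact: pgenE. Qed.

Lemma arr_astarE i : arr_astar k i = arr (i, true).
Proof. exact: pgenE. Qed.

Lemma pathalg_linear_eq (M : lmodType k) (F G : pathalg k n -> M) :
  linear F -> linear G ->
  (forall v s, valid v s -> F (path_elt (v, s)) = G (path_elt (v, s))) ->
  F =1 G.
Proof.
move=> linF linG eqFG; apply: freeg_linear_eq => // -[[v s] vs].
by rewrite -[<< _ >>]/(pgen k _) pgenE eqFG.
Qed.

Lemma fglift_path_elt (M : lmodType k) (g : 'I_n * seq (arrow n) -> M) v s :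
  fglift (fun r : qpath n => g (val r)) (path_elt (v, s)) =
  if valid v s then g (v, s) else 0.
Proof.
rewrite /path_elt; case: insubP => [u uv valu|/negPf /= -> /=].
  by rewrite /= in uv; rewrite uv /= /pgen liftU scale1r valu.
exact: linear0.
Qed.

Lemma mulQ_linear_l y : linear ((@mulQ k n)^~ y).
Proof. exact: linearP. Qed.

(** Linearity on the left is built into the outer [fglift]; on the right it is tested on paths
    placed in the left factor. *)
Lemma mulQ_linear_r x : linear (mulQ x).
Proof.
move=> c y z; rewrite /mulQ.
rewrite -[fglift _ x]/(mulQ x (c *: y + z)).
pose F u := c *: mulQ u y + mulQ u z.
apply: (@pathalg_linear_eq _ ((@mulQ k n)^~ (c *: y + z)) F).
- exact: mulQ_linear_l.
- move=> d u u'; rewrite /F !mulQ_linear_l !scalerDr !scalerA mulrC.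
  by rewrite addrACA.
- move=> v s vs; rewrite /F /path_elt insubT /= /mulQ /pgen !liftU !scale1r.
  exact: linearP.
Qed.

HB.instance Definition _ x :=
  GRing.isLinear.Build k (pathalg k n) (pathalg k n) *:%R (mulQ x) (mulQ_linear_r x).

Lemma mul0Q y : mulQ 0 y = 0.
Proof. exact: (linear0 (fglift _)). Qed.

Lemma mulQ0 x : mulQ x 0 = 0.
Proof. exact: linear0. Qed.

Lemma scaleQl c x y : mulQ (c *: x) y = c *: mulQ x y.
Proof. exact: (linearZ_LR (fglift _)). Qed.

Lemma scaleQr c x y : mulQ x (c *: y) = c *: mulQ x y.
Proof. exact: linearZ_LR. Qed.

Lemma mulQBl x y z : mulQ (x - y) z = mulQ x z - mulQ y z.
Proof. exact: (linearB (fglift _)). Qed.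

Lemma mulQBr x y z : mulQ x (y - z) = mulQ x y - mulQ x z.
Proof. exact: linearB. Qed.

Lemma mulQ_path v s w t :
  mulQ (path_elt (v, s)) (path_elt (w, t)) =
  if [&& valid v s, valid w t & pend v s == w]
  then path_elt (v, s ++ t) else 0.
Proof.
case vs: (valid v s); last by rewrite (path_elt_invalid (negbT vs)) mul0Q.
case wt: (valid w t); last by rewrite (path_elt_invalid (negbT wt)) mulQ0.
rewrite {1}/path_elt insubT {1}/path_elt insubT /= /mulQ /pgen liftU scale1r.
by rewrite liftU scale1r /pmul /qend /qstart /=; case: ifP.
Qed.

Lemma pathalg_mul_eq (M : lmodType k) (F G : pathalg k n -> pathalg k n -> M) :
  (forall y, linear (F^~ y)) -> (forall x, linear (F x)) ->
  (forall y, linear (G^~ y)) -> (forall x, linear (G x)) ->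
  (forall v s w t, valid v s -> valid w t ->
     F (path_elt (v, s)) (path_elt (w, t)) =
     G (path_elt (v, s)) (path_elt (w, t))) ->
  forall x y, F x y = G x y.
Proof.
move=> Fl Fr Gl Gr eqFG x y.
apply: (pathalg_linear_eq (Fl y) (Gl y)) => v s vs.
by apply: (pathalg_linear_eq (Fr _) (Gr _)) => w t wt; apply: eqFG.
Qed.

Lemma path_elt_cons v a s : valid v (a :: s) ->
  path_elt (v, a :: s) = mulQ (arr a) (path_elt (atgt a, s)).
Proof.
by rewrite [valid _ _]/= => /andP[/eqP <- vs]; rewrite mulQ_path /= vs !eqxx.
Qed.

Lemma mul_evert v w :
  mulQ (evert k v) (evert k w) = if v == w then evert k v else 0.
Proof. by rewrite !evertE mulQ_path. Qed.

Lemma mul_evert_arr v a :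
  mulQ (evert k v) (arr a) = if v == asrc a then arr a else 0.
Proof. by rewrite evertE mulQ_path /= eqxx; case: eqP => [->|]. Qed.

Lemma mul_arr_evert v a :
  mulQ (arr a) (evert k v) = if atgt a == v then arr a else 0.
Proof. by rewrite evertE mulQ_path /= eqxx. Qed.

Lemma relqE (q : 'I_n -> k) i :
  relq q i = mulQ (arr (i, false)) (arr (i, true))
    - q i *: mulQ (arr (ord_pred i, true)) (arr (ord_pred i, false)).
Proof. by rewrite /relq !arr_aE !arr_astarE. Qed.

Lemma relq_idealq (q : 'I_n -> k) i : idealq q (relq q i).
Proof.
(* Both terms of the relation are loops at [i], so multiplying by [evert k i] on either side changes
   nothing. *)
exists [:: (evert k i, i, evert k i)]; rewrite big_seq1 /= relqE.
rewrite evertE !mulQ_path /atgt /asrc /= !eqxx ord_predK.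
rewrite mulQBr scaleQr mulQBl scaleQl !mulQ_path /= /asrc /atgt /=.
by rewrite ?ord_predK !eqxx /= !mulQ_path /= /asrc /atgt /= ?ord_predK !eqxx.
Qed.

End PathAlgebra.

(** * Arrows and adjacency-preserving vertex maps of the n-cycle *)

Section CyclicIndices.
Variable n : nat.
Implicit Types (i : 'I_n) (a b : arrow n).

Lemma ordS_neq i : (1 < n)%N -> ordS i != i.
Proof.
move=> n_gt1; rewrite -val_eqE /=; have := ltn_ord i.
rewrite leq_eqVlt => /orP[/eqP e|lt]; last by rewrite modn_small //; lia.
by rewrite {1}e modnn; lia.
Qed.

Lemma ordSS_neq i : (2 < n)%N -> ordS (ordS i) != i.
Proof.
move=> n_gt2; apply/eqP => e.
have : (i.+2 = i %[mod n])%N.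
  by have := congr1 val e; rewrite /= -addn1 modnDml addn1 => ->; rewrite modn_small.
by move=> /eqP; rewrite -addn2 -{2}[i : nat]addn0 eqn_modDl modn_small ?mod0n.
Qed.

Lemma asrc_neq_atgt a : (1 < n)%N -> asrc a != atgt a.
Proof.
case: a => i [] n_gt1; rewrite /asrc /atgt /=; first exact: ordS_neq.
by rewrite eq_sym ordS_neq.
Qed.

(** A starred arrow with these ends would make two steps of [ordS] close up. This happens for
    [n = 2], where [a_0] and [a_1^*] are parallel. *)
Lemma forward_arrow i b : (2 < n)%N ->
  asrc b = i -> atgt b = ordS i -> b = (i, false).
Proof.
case: b => j [] n_gt2; rewrite /asrc /atgt /=; last by move=> ->.
by move=> <- /eqP; rewrite eq_sym (negPf (ordSS_neq _ _)).
Qed.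

Lemma backward_arrow i b : (2 < n)%N ->
  asrc b = ordS i -> atgt b = i -> b = (i, true).
Proof.
case: b => j [] n_gt2; rewrite /asrc /atgt /=; first by move=> _ ->.
by move=> -> /eqP; rewrite (negPf (ordSS_neq _ _)).
Qed.

Lemma iter_ordS_transitive i j : exists m, iter m (@ordS n) i = j.
Proof.
(* Adding [n] first keeps the truncated subtraction exact. *)
exists (j + n - i)%N; apply: val_inj => /=.
have iterE m : nat_of_ord (iter m (@ordS n) i) = ((i + m) %% n)%N.
  elim: m => [|m IHm] /=; first by rewrite addn0 modn_small.
  by rewrite IHm -addn1 modnDml addn1 addnS.
rewrite iterE subnKC; first by rewrite modnDr modn_small.
by rewrite (leq_trans (ltnW (ltn_ord i))) // leq_addl.
Qed.

(** A forward step followed by a backward one would give [sg i = sg (ordS (ordS i))], against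
    injectivity. Hence a single forward step propagates around the whole cycle. *)
Lemma cycle_graph_injection (sg : 'I_n -> 'I_n) : (2 < n)%N -> injective sg ->
  (forall i, sg (ordS i) = ordS (sg i) \/ sg i = ordS (sg (ordS i))) ->
  (forall i, sg (ordS i) = ordS (sg i)) \/ (forall i, sg i = ordS (sg (ordS i))).
Proof.
move=> n_gt2 inj_sg step.
have propagate i : sg (ordS i) = ordS (sg i) ->
    sg (ordS (ordS i)) = ordS (sg (ordS i)).
  move=> Pi; case: (step (ordS i)) => // e; move: e; rewrite Pi.
  by move/(can_inj (@ordSK n))/inj_sg/esym/eqP; rewrite (negPf (ordSS_neq _ _)).
case: (pickP (fun i => sg (ordS i) == ordS (sg i))) => [i /eqP Pi|none].
  left=> j; have [m <-] := iter_ordS_transitive i j.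
  by elim: m => //= m; apply: propagate.
by right=> i; case: (step i) => // /eqP; rewrite none.
Qed.

End CyclicIndices.

(** * Path coefficients, characters and twisted derivations *)

Section Functionals.
Variables (k : fieldType) (n : nat).
Implicit Types (v w : 'I_n) (s t : seq (arrow n)) (a b : arrow n).
Implicit Types (x y : pathalg k n).

(** Indexed by raw pairs, so that the pieces of a cut path need no proof of validity. *)
Definition path_coef (r : 'I_n * seq (arrow n)) : pathalg k n -> k :=
  fglift (fun u : qpath n => (val u == r)%:R : k^o).

Lemma path_coef_scalar r : scalar (path_coef r).
Proof. by move=> c x y; rewrite /path_coef fglift_linear. Qed.

HB.instance Definition _ r :=
  GRing.isLinear.Build k (pathalg k n) k *%R (path_coef r) (path_coef_scalar r).

Definition vcoef v := path_coef (v, [::]).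
Definition acoef a := path_coef (asrc a, [:: a]).
Definition aacoef a b := path_coef (asrc a, [:: a; b]).

HB.instance Definition _ v := GRing.Linear.on (vcoef v).
HB.instance Definition _ a := GRing.Linear.on (acoef a).
HB.instance Definition _ a b := GRing.Linear.on (aacoef a b).

Lemma path_coef_path_elt r v s : valid v s ->
  path_coef r (path_elt k (v, s)) = ((v, s) == r)%:R.
Proof.
by move=> vs; rewrite /path_coef (fglift_path_elt (fun u => (u == r)%:R : k^o)) vs.
Qed.

Lemma path_coef_mulQ_path r v s w t : valid v s -> valid w t ->
  path_coef r (mulQ (path_elt k (v, s)) (path_elt k (w, t))) =
  ((pend v s == w) && ((v, s ++ t) == r))%:R.
Proof.
move=> vs wt; rewrite mulQ_path vs wt; case: eqP => [e|_] /=.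
  by rewrite path_coef_path_elt // valid_cat vs e.
exact: linear0.
Qed.

Lemma linear_mulQ_l (g : {scalar pathalg k n}) y :
  scalar (fun x => g (mulQ x y)).
Proof. by move=> c x x'; rewrite mulQ_linear_l linearP. Qed.

Lemma linear_mulQ_r (g : {scalar pathalg k n}) x :
  scalar (fun y => g (mulQ x y)).
Proof. by move=> c y y'; rewrite mulQ_linear_r linearP. Qed.

(** A path factors into two paths once for each place where it can be cut, trivial pieces
    included. *)
Lemma path_coefM v s x y :
  path_coef (v, s) (mulQ x y) =
  \sum_(i < (size s).+1) path_coef (v, take i s) x *
    path_coef (pend v (take i s), drop i s) y.
Proof.
pose G x y : k := \sum_(i < (size s).+1) path_coef (v, take i s) x *
    path_coef (pend v (take i s), drop i s) y.
apply: (@pathalg_mul_eq _ _ k^o (fun x y => path_coef (v, s) (mulQ x y)) G).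
- exact: linear_mulQ_l.
- exact: linear_mulQ_r.
- move=> {}y c u u'; rewrite /G -[RHS]/(c * _ + _) mulr_sumr -big_split.
  by apply: eq_bigr => i _; rewrite linearP /=; ring.
- move=> {}x c u u'; rewrite /G -[RHS]/(c * _ + _) mulr_sumr -big_split.
  by apply: eq_bigr => i _; rewrite linearP /=; ring.
move=> v' s' w t vs wt; rewrite path_coef_mulQ_path // /G.
under eq_bigr => i _ do rewrite !path_coef_path_elt // -natrM mulnb.
rewrite !xpair_eqE; case: and3P => [[/eqP <- /eqP -> /eqP <-]|notcat].
  (* Only the cut at the length of [s'] contributes. *)
  have lt_i : (size s' < (size (s' ++ t)).+1)%N by rewrite size_cat ltnS leq_addr.
  rewrite (bigD1 (Ordinal lt_i)) //= take_size_cat // drop_size_cat // !eqxx.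
  rewrite big1 ?addr0 // => i ne_i; case: eqP => //= -[] e.
  move/eqP: ne_i => []; apply: val_inj => /=.
  by have := congr1 size e; rewrite size_take_min (minn_idPl _) // -ltnS.
rewrite big1 // => i _; case: eqP => //= -[ev es]; case: eqP => //= -[ew et].
by case: notcat; rewrite ev es et ew cat_take_drop !eqxx.
Qed.

Lemma vcoefM v x y : vcoef v (mulQ x y) = vcoef v x * vcoef v y.
Proof. by rewrite /vcoef path_coefM big_ord1. Qed.

Lemma acoefM a x y :
  acoef a (mulQ x y) =
  vcoef (asrc a) x * acoef a y + acoef a x * vcoef (atgt a) y.
Proof. by rewrite /acoef path_coefM !big_ord_recl big_ord0 addr0. Qed.

Lemma aacoefM a b x y : atgt a = asrc b ->
  aacoef a b (mulQ x y) =
  vcoef (asrc a) x * aacoef a b y + acoef a x * acoef b y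
  + aacoef a b x * vcoef (atgt b) y.
Proof.
move=> ab; rewrite /aacoef path_coefM !big_ord_recl big_ord0 addr0 addrA /=.
by rewrite ab.
Qed.

Lemma vcoef_evert v w : vcoef v (evert k w) = (w == v)%:R.
Proof. by rewrite evertE /vcoef /acoef path_coef_path_elt // xpair_eqE andbT. Qed.

Lemma vcoef_arr v a : vcoef v (arr k a) = 0.
Proof. by rewrite /vcoef /arr path_coef_path_elt ?xpair_eqE ?andbF //= eqxx. Qed.

Lemma vcoef_one v : vcoef v (oneQ k n) = 1.
Proof.
rewrite linear_sum (bigD1 v) //= vcoef_evert eqxx big1 ?addr0 // => w /negPf nw.
by rewrite vcoef_evert nw.
Qed.

Lemma acoef_arr a b : acoef a (arr k b) = (b == a)%:R.
Proof.
rewrite /acoef /arr path_coef_path_elt ?xpair_eqE /= ?eqxx // eqseq_cons andbT.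
by case: (b =P a) => [->|_]; rewrite ?eqxx ?andbF.
Qed.

Lemma vcoef_relq v (q : 'I_n -> k) i : vcoef v (relq q i) = 0.
Proof. by rewrite relqE linearB linearZ /= !vcoefM !vcoef_arr !mul0r mulr0 subr0. Qed.

Lemma acoef_relq a (q : 'I_n -> k) i : acoef a (relq q i) = 0.
Proof.
rewrite relqE linearB linearZ /= !acoefM !vcoef_arr !(mul0r, mulr0) addr0.
by rewrite mulr0 subr0.
Qed.

(* The weights [p j] and [1] are those that make this functional vanish on
   the relation of A_n(p) at [j]. *)
Definition loopcoef (p : 'I_n -> k) j x : k :=
  p j * aacoef (j, false) (j, true) x
  + aacoef (ord_pred j, true) (ord_pred j, false) x.

Lemma loopcoef_scalar p j : scalar (loopcoef p j).
Proof. by move=> c x y; rewrite /loopcoef !linearP /=; ring. Qed.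

HB.instance Definition _ p j :=
  GRing.isLinear.Build k (pathalg k n) k *%R (loopcoef p j) (loopcoef_scalar p j).

Lemma loopcoefM p j x y :
  loopcoef p j (mulQ x y) =
  vcoef j x * loopcoef p j y
  + p j * (acoef (j, false) x * acoef (j, true) y)
  + acoef (ord_pred j, true) x * acoef (ord_pred j, false) y
  + loopcoef p j x * vcoef j y.
Proof.
rewrite /loopcoef !aacoefM // /asrc /atgt /= ord_predK; ring.
Qed.

Lemma loopcoef_relq (p : 'I_n -> k) j i : loopcoef p j (relq p i) = 0.
Proof.
rewrite relqE linearB linearZ /= !loopcoefM !vcoef_arr !acoef_arr.
rewrite !xpair_eqE !(andbF, andbT, mul0r, mulr0, addr0, add0r).
rewrite (inj_eq (can_inj (@ord_predK n))) -!natrM !mulnb !andbb.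
by case: eqP => [->|_]; rewrite ?subrr ?mulr0 ?subr0.
Qed.

Lemma vcoef_idealq v (q : 'I_n -> k) x : idealq q x -> vcoef v x = 0.
Proof.
case=> s ->; rewrite linear_sum big1 // => t _.
by rewrite /= !vcoefM vcoef_relq mulr0 mul0r.
Qed.

(** The relations are homogeneous of degree two, so their coefficients in degrees 0 and 1 vanish;
    the Leibniz rule extends this to the ideal. *)
Lemma acoef_idealq a (q : 'I_n -> k) x : idealq q x -> acoef a x = 0.
Proof.
case=> s ->; rewrite linear_sum big1 // => t _.
by rewrite /= !acoefM !vcoefM acoef_relq !vcoef_relq; ring.
Qed.

(** Each term in the expansion of a product around a relation contains a coefficient of the relation
    in degree 0 or 1, or its [loopcoef]; all of these vanish. *)
Lemma loopcoef_idealq (p : 'I_n -> k) j x : idealq p x -> loopcoef p j x = 0.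
Proof.
case=> s ->; rewrite linear_sum big1 // => t _.
by rewrite /= !loopcoefM !acoefM !vcoefM !acoef_relq !vcoef_relq loopcoef_relq; ring.
Qed.

Lemma character_vcoef (chi : pathalg k n -> k) : (1 < n)%N ->
  scalar chi -> (forall x y, chi (mulQ x y) = chi x * chi y) ->
  chi (oneQ k n) = 1 -> exists v, chi =1 vcoef v.
Proof.
move=> n_gt1 lin_chi chiM chi1.
pose X : {scalar pathalg k n} :=
  HB.pack chi (GRing.isLinear.Build _ _ _ _ chi lin_chi).
have chi0 : chi 0 = 0 by exact: (linear0 X).
have chi_sum : \sum_(v < n) chi (evert k v) = 1.
  by rewrite -chi1 -[RHS]/(X _) linear_sum.
have [v nz_v] : exists v, chi (evert k v) != 0.
  apply/existsP; rewrite -[_ _ _]negbK negb_exists; apply/forallP => all0.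
  move: chi_sum; rewrite big1 => [/esym/eqP|v _]; first by rewrite oner_eq0.
  by apply/eqP; have := all0 v; rewrite negbK.
(* The vertices are orthogonal idempotents, so [chi] is 1 on the one where it is nonzero and 0 on
   the others. *)
have chi_evert w : chi (evert k w) = (w == v)%:R.
  have := chiM (evert k v) (evert k w); rewrite mul_evert eq_sym.
  case: eqP => [->|_]; last first.
    by rewrite chi0 => /esym/eqP; rewrite mulf_eq0 (negPf nz_v) => /eqP.
  by move=> e; apply: (mulfI nz_v); rewrite -e mulr1.
(* An arrow absorbs the idempotents of its two ends; these ends differ, so [chi] kills one of
   them. *)
have chi_arr a : chi (arr k a) = 0.
  have := chiM (evert k (asrc a)) (arr k a); rewrite mul_evert_arr eqxx => ->.
  have := chiM (arr k a) (evert k (atgt a)); rewrite mul_arr_evert eqxx => ->.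
  rewrite !chi_evert mulrCA -natrM mulnb; case: (_ =P v) => [<-|_]; last by rewrite mulr0.
  by rewrite eq_sym (negPf (asrc_neq_atgt _ _)) // mulr0.
exists v; apply: (@pathalg_linear_eq _ _ k^o) => [|c x y|w [|a s] vs].
- exact: lin_chi.
- exact: (linearP (vcoef v)).
- by rewrite -evertE chi_evert vcoef_evert.
- by rewrite path_elt_cons // chiM vcoefM chi_arr vcoef_arr !mul0r.
Qed.

(** Splitting off the first arrow of a nontrivial path, both Leibniz terms vanish. So [delta] is a
    combination of the vertex coefficients. *)
Lemma twisted_derivation_eq0 (delta : pathalg k n -> k) u v :
  scalar delta ->
  (forall x y, delta (mulQ x y) = vcoef u x * delta y + delta x * vcoef v y) ->
  (forall a, delta (arr k a) = 0) ->
  forall x, (forall w, vcoef w x = 0) -> delta x = 0.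
Proof.
move=> lin_delta deltaM delta_arr x x0.
pose G y : k := \sum_w delta (evert k w) * vcoef w y.
suff -> : delta x = G x by rewrite /G big1 // => w _; rewrite x0 mulr0.
move: x {x0}; apply: (@pathalg_linear_eq _ _ k^o) => [|c x y|w [|a s] vs].
- exact: lin_delta.
- rewrite /G -[RHS]/(c * _ + _) mulr_sumr -big_split; apply: eq_bigr => w _.
  by rewrite linearP /=; ring.
- rewrite -evertE /G (bigD1 w) //= vcoef_evert eqxx mulr1 big1 ?addr0 //.
  by move=> i /negPf nw; rewrite vcoef_evert eq_sym nw mulr0.
- rewrite path_elt_cons // deltaM vcoef_arr delta_arr !mul0r addr0 /G big1 //.
  by move=> i _; rewrite vcoefM vcoef_arr mul0r mulr0.
Qed.

(** Apply the Leibniz rule to an arrow multiplied by the idempotent of either end; the arrow itself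
    has no vertex coefficients. *)
Lemma twisted_derivation_arr (delta : pathalg k n -> k) u v a :
  (forall x y, delta (mulQ x y) = vcoef u x * delta y + delta x * vcoef v y) ->
  delta (arr k a) != 0 -> asrc a = u /\ atgt a = v.
Proof.
move=> deltaM nz; split; apply/eqP.
  have := deltaM (evert k (asrc a)) (arr k a).
  rewrite mul_evert_arr eqxx vcoef_evert vcoef_arr mulr0 addr0.
  by case: eqP => // _; rewrite mul0r => /eqP; rewrite (negPf nz).
have := deltaM (arr k a) (evert k (atgt a)).
rewrite mul_arr_evert eqxx vcoef_evert vcoef_arr mul0r add0r.
by case: eqP => // _; rewrite mulr0 => /eqP; rewrite (negPf nz).
Qed.

End Functionals.

(** * From an isomorphism to the relation between the parameters *)

Section Necessity.
Variables (k : fieldType) (n : nat) (q p : 'I_n -> k).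
Variable f : pathalg k n -> pathalg k n.
Hypothesis n_gt2 : (2 < n)%N.
Hypothesis f_compat : forall x y, idealq q (x - y) -> idealq p (f x - f y).
Hypothesis fD : forall x y, idealq p (f (x + y) - (f x + f y)).
Hypothesis fZ : forall (c : k) x, idealq p (f (c *: x) - c *: f x).
Hypothesis fM : forall x y, idealq p (f (mulQ x y) - mulQ (f x) (f y)).
Hypothesis f1 : idealq p (f (oneQ k n) - oneQ k n).
Hypothesis f_surj : forall y, exists x, idealq p (f x - y).

Section Pullback.
Variable g : {scalar pathalg k n}.
Hypothesis g_ideal : forall x, idealq p x -> g x = 0.

(** [f] is linear and multiplicative only modulo the ideal of A_n(p); a functional vanishing on that
    ideal turns these congruences into equalities. *)
Lemma functional_eq_mod x y : idealq p (x - y) -> g x = g y.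
Proof. by move/g_ideal/eqP; rewrite linearB subr_eq0 => /eqP. Qed.

Lemma pullback_scalar : scalar (g \o f).
Proof.
move=> c x y; rewrite /= (functional_eq_mod (fD _ _)) linearD /=.
by rewrite (functional_eq_mod (fZ _ _)) linearZ.
Qed.

Lemma pullbackM x y : g (f (mulQ x y)) = g (mulQ (f x) (f y)).
Proof. exact: functional_eq_mod. Qed.

Lemma pullback_ideal x : idealq q x -> g (f x) = 0.
Proof.
rewrite -{1}[x]subr0 => /f_compat/functional_eq_mod ->.
(* [f 0] need not be 0, but linearity of [g \o f] forces [g (f 0) = 0]. *)
by have := pullback_scalar (-1) 0 0; rewrite /= scaler0 addr0 mulN1r addNr.
Qed.

End Pullback.

(** The vertex map goes against [f]: it sends a vertex of A_n(p) to the vertex of A_n(q) whose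
    character is the pulled-back one. *)
Lemma vcoef_pullback :
  exists sg : 'I_n -> 'I_n, forall v x, vcoef v (f x) = vcoef (sg v) x.
Proof.
have ex v : exists w, forall x, vcoef v (f x) = vcoef w x.
  apply: character_vcoef (ltnW n_gt2) _ _ _.
  - exact: (pullback_scalar (@vcoef_idealq _ _ v p)).
  - by move=> x y; rewrite (pullbackM (@vcoef_idealq _ _ v p)) /= vcoefM.
  - by rewrite (functional_eq_mod (@vcoef_idealq _ _ v p) f1) /= vcoef_one.
by have [sg sgE] := fin_all_exists ex; exists sg.
Qed.

Variable sg : 'I_n -> 'I_n.
Hypothesis sgE : forall v x, vcoef v (f x) = vcoef (sg v) x.

(** A preimage of [evert k v] has coefficient 1 at [sg v], and coefficient 0 at [sg w] for every
    other [w]. *)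
Lemma vertex_map_inj : injective sg.
Proof.
move=> v w eq_sg; have [x fx] := f_surj (evert k v).
have := functional_eq_mod (@vcoef_idealq _ _ v p) fx.
have := functional_eq_mod (@vcoef_idealq _ _ w p) fx.
rewrite /= !sgE eq_sg => -> /eqP; rewrite !vcoef_evert eqxx.
by case: (v =P w) => // _; rewrite eq_sym oner_eq0.
Qed.

Lemma acoef_pullbackM a x y :
  acoef a (f (mulQ x y)) = vcoef (sg (asrc a)) x * acoef a (f y)
                         + acoef a (f x) * vcoef (sg (atgt a)) y.
Proof. by rewrite (pullbackM (@acoef_idealq _ _ a p)) /= acoefM !sgE. Qed.

(** Otherwise the twisted derivation [acoef a \o f] kills all arrows. A preimage of [arr k a] has no
    vertex coefficients, so it would be killed too, although its value is 1. *)
Lemma acoef_pullback_neq0 a :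
  exists2 b, acoef a (f (arr k b)) != 0 &
    asrc b = sg (asrc a) /\ atgt b = sg (atgt a).
Proof.
suff [b nzb] : exists b, acoef a (f (arr k b)) != 0.
  exists b => //.
  exact: (twisted_derivation_arr (delta := acoef a \o f) (acoef_pullbackM a)).
apply/existsP; rewrite -[_ _ _]negbK negb_exists; apply/forallP => all0.
have [x fx] := f_surj (arr k a).
have := functional_eq_mod (@acoef_idealq _ _ a p) fx.
rewrite /= acoef_arr eqxx => /eqP; rewrite -[_ == _]negbK => /negP[].
rewrite -[acoef a (f x)]/((acoef a \o f) x).
rewrite (twisted_derivation_eq0 (pullback_scalar (@acoef_idealq _ _ a p))
  (acoef_pullbackM a)) ?(eq_sym 0) ?oner_neq0 //.
- by move=> b; apply/eqP; have := all0 b; rewrite negbK.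
- move=> w; have [w' <-] : exists w', sg w' = w.
    by have [sg' _ sgK] := injF_bij vertex_map_inj; exists (sg' w).
  by rewrite -sgE (functional_eq_mod (@vcoef_idealq _ _ w' p) fx) /= vcoef_arr.
Qed.

Lemma vertex_map_step i : sg (ordS i) = ordS (sg i) \/ sg i = ordS (sg (ordS i)).
Proof.
have [[j []] _] := acoef_pullback_neq0 (i, false).
  by rewrite /asrc /atgt /= => -[<- <-]; right.
by rewrite /asrc /atgt /= => -[<- <-]; left.
Qed.

(** The matrix of [f] on arrows; an entry is nonzero exactly when [sg] carries the ends of [a] to
    those of [b]. *)
Let d a b := acoef a (f (arr k b)).

Lemma acoef_pullback_arr0 a b : asrc b != sg (asrc a) \/ atgt b != sg (atgt a) ->
  d a b = 0.
Proof.
move=> ne; apply/eqP; rewrite -[_ == _]negbK; apply/negP => nz.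
have [/= es et] := twisted_derivation_arr (delta := acoef a \o f) (acoef_pullbackM a) nz.
by case: ne; rewrite ?es ?et eqxx.
Qed.

Lemma loopcoef_pullback_relq j i :
  p j * (d (j, false) (i, false) * d (j, true) (i, true))
  + d (ord_pred j, true) (i, false) * d (ord_pred j, false) (i, true)
  = q i * (p j * (d (j, false) (ord_pred i, true) * d (j, true) (ord_pred i, false))
  + d (ord_pred j, true) (ord_pred i, true) * d (ord_pred j, false) (ord_pred i, false)).
Proof.
have idl := @loopcoef_idealq k n p j.
have := pullback_ideal idl (relq_idealq q i).
have lin := pullback_scalar idl.
pose g : {scalar pathalg k n} :=
  HB.pack (loopcoef p j \o f) (GRing.isLinear.Build _ _ _ _ _ lin).
rewrite /= -[loopcoef p j (f _)]/(g _) relqE linearB linearZ /=.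
have gM a b : loopcoef p j (f (mulQ (arr k a) (arr k b))) =
    p j * (d (j, false) a * d (j, true) b)
    + d (ord_pred j, true) a * d (ord_pred j, false) b.
  by rewrite (pullbackM idl) /= loopcoefM !sgE !vcoef_arr mul0r mulr0 addr0 add0r.
by rewrite !gM => /eqP; rewrite subr_eq0 => /eqP.
Qed.

Lemma acoef_pullback_neq0_arr a b :
  asrc b = sg (asrc a) -> atgt b = sg (atgt a) -> d a b != 0.
Proof.
move=> es et; have [c nz [cs ct]] := acoef_pullback_neq0 a.
suff -> : b = c by [].
case: c cs ct {nz} => i [] /=; rewrite -es -et {1}/asrc {1}/atgt /= => e e'.
  by apply: backward_arrow.
by apply: forward_arrow; rewrite // -?e -?e'.
Qed.

Lemma iso_parameters : (forall i, q i != 0) ->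
  exists alpha : 'I_n -> k, (forall i, alpha i != 0) /\
  (((forall i, sg (ordS i) = ordS (sg i)) /\
    (forall j, p j = alpha (ord_pred (sg j)) / alpha (sg j) * q (sg j)))
   \/ ((forall i, sg i = ordS (sg (ordS i))) /\
    (forall j, p j = alpha (sg j) / alpha (ord_pred (sg j)) * (q (sg j))^-1))).
Proof.
move=> q_neq0; have [tau sgK tauK] := injF_bij vertex_map_inj.
have [fwd|bwd] := cycle_graph_injection n_gt2 vertex_map_inj vertex_map_step.
  (* The scalar by which [f] acts on the pair formed by an arrow and its reverse; the relation at
     [sg j] becomes [p j * gm j = q (sg j) * gm (ord_pred j)]. *)
  pose gm j := d (j, false) (sg j, false) * d (j, true) (sg j, true).
  have gm_neq0 j : gm j != 0.
    by rewrite mulf_neq0 // acoef_pullback_neq0_arr // /asrc /atgt /= fwd.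
  exists (gm \o tau); split=> [i|]; first exact: gm_neq0.
  left; split=> // j; have := loopcoef_pullback_relq j (sg j).
  have sgP : ord_pred (sg j) = sg (ord_pred j).
    by rewrite -{1}[j]ord_predK fwd ordSK.
  rewrite (@acoef_pullback_arr0 (ord_pred j, true) (sg j, false)); last first.
    right; rewrite /atgt /= -sgP -{1}[sg j]ord_predK; exact: ordSS_neq.
  rewrite (@acoef_pullback_arr0 (j, false) (ord_pred (sg j), true)); last first.
    right; rewrite /atgt /= fwd -{2}[sg j]ord_predK eq_sym; exact: ordSS_neq.
  rewrite /= sgP !sgK !mul0r mulr0 addr0 add0r [X in q _ * X]mulrC => e.
  apply: (mulIf (gm_neq0 j)); rewrite e -/(gm (ord_pred j)); field.
  exact: gm_neq0.
pose gm j := d (j, false) (sg (ordS j), true) * d (j, true) (sg (ordS j), false).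
have gm_neq0 j : gm j != 0.
  by rewrite mulf_neq0 // acoef_pullback_neq0_arr // /asrc /atgt /= -bwd.
(* A reflection matches the edge [j] with the edge [sg (ordS j)], whence the shift by [ord_pred].
   The relation now reads [gm (ord_pred j) = q (sg j) * (p j * gm j)]. *)
exists (fun i => gm (ord_pred (tau i))); split=> [i|]; first exact: gm_neq0.
right; split=> // j; have := loopcoef_pullback_relq j (sg j).
have sgP : ord_pred (sg j) = sg (ordS j) by rewrite bwd ordSK.
rewrite (@acoef_pullback_arr0 (j, false) (sg j, false)); last first.
  right; rewrite /atgt /= {1}bwd; exact: ordSS_neq.
rewrite (@acoef_pullback_arr0 (ord_pred j, true) (ord_pred (sg j), true)); last first.
  right; rewrite /atgt /= (bwd (ord_pred j)) ord_predK -{2}[sg j]ord_predK eq_sym.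
  exact: ordSS_neq.
rewrite /= sgP !sgK ordSK !mul0r mulr0 addr0 add0r.
have -> : d (ord_pred j, true) (sg j, false) * d (ord_pred j, false) (sg j, true)
   = gm (ord_pred j) by rewrite /gm ord_predK mulrC.
rewrite -/(gm j) => ->; field.
by rewrite gm_neq0 q_neq0.
Qed.

End Necessity.

(** * From the parameters to an isomorphism, by relabelling and rescaling arrows *)

Section Relabelling.
Variables (k : fieldType) (n : nat).
Implicit Types (x y : pathalg k n).

Lemma idealq0 (q : 'I_n -> k) : idealq q 0.
Proof. by exists [::]; rewrite big_nil. Qed.

Lemma idealq_morphism (q p : 'I_n -> k) (c : 'I_n -> k) (tau : 'I_n -> 'I_n)
    (F : {linear pathalg k n -> pathalg k n}) :
  (forall x y, F (mulQ x y) = mulQ (F x) (F y)) ->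
  (forall i, F (relq q i) = c i *: relq p (tau i)) ->
  forall x, idealq q x -> idealq p (F x).
Proof.
move=> FM Frel x [s ->].
exists [seq (c t.1.2 *: F t.1.1, tau t.1.2, F t.2) | t <- s].
rewrite big_map linear_sum; apply: eq_bigr => t _ /=.
by rewrite !FM Frel scaleQr !scaleQl.
Qed.

(** As the factors [c i] are invertible, the inverse [G] also maps ideal to ideal, which gives
    injectivity on the quotients. *)
Lemma An_iso_of_automorphism (q p : 'I_n -> k) (c : 'I_n -> k)
    (tau sg : 'I_n -> 'I_n) (F G : {linear pathalg k n -> pathalg k n}) :
  cancel F G -> cancel G F -> (forall x y, F (mulQ x y) = mulQ (F x) (F y)) ->
  F (oneQ k n) = oneQ k n ->
  (forall i, c i != 0) -> cancel sg tau ->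
  (forall i, F (relq q i) = c i *: relq p (tau i)) -> An_iso q p.
Proof.
move=> FK GK FM F1 c_neq0 sgK Frel.
have GM x y : G (mulQ x y) = mulQ (G x) (G y).
  by rewrite -[x in LHS]GK -[y in LHS]GK -FM FK.
have Grel j : G (relq p j) = (c (sg j))^-1 *: relq q (sg j).
  by rewrite -[relq q _]FK Frel linearZ /= scalerA mulVf ?scale1r ?sgK.
exists F; split; first by move=> x y /(idealq_morphism FM Frel); rewrite linearB.
split; first by move=> x y; rewrite linearD subrr; apply: idealq0.
split; first by move=> a x; rewrite linearZ subrr; apply: idealq0.
split; first by move=> x y; rewrite FM subrr; apply: idealq0.
split; first by rewrite F1 subrr; apply: idealq0.
split; last by move=> y; exists (G y); rewrite GK subrr; apply: idealq0.
by move=> x y /(idealq_morphism GM Grel); rewrite linearB /= !FK.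
Qed.

Section WeightedMap.
Variables (phi : arrow n -> arrow n) (psi : 'I_n -> 'I_n) (w : arrow n -> k).

(** The substitution sending each vertex [v] to [psi v] and each arrow [a] to [w a] times
    [phi a]. *)
Definition wmap : pathalg k n -> pathalg k n :=
  fglift (fun r : qpath n => (\prod_(a <- (val r).2) w a)
                    *: path_elt k (psi (val r).1, map phi (val r).2)).

HB.instance Definition _ := GRing.Linear.on wmap.

Hypothesis psi_inj : injective psi.
Hypothesis phi_src : forall a, asrc (phi a) = psi (asrc a).
Hypothesis phi_tgt : forall a, atgt (phi a) = psi (atgt a).

Lemma valid_map v s : valid (psi v) (map phi s) = valid v s.
Proof.
elim: s v => //= a s IHs v.
by rewrite phi_src (inj_eq psi_inj) phi_tgt IHs.
Qed.

Lemma pend_map v s : pend (psi v) (map phi s) = psi (pend v s).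
Proof. by elim: s v => //= a s IHs v; rewrite phi_tgt IHs. Qed.

Lemma wmap_path v s : wmap (path_elt k (v, s)) =
  (\prod_(a <- s) w a) *: path_elt k (psi v, map phi s).
Proof.
rewrite /wmap (fglift_path_elt (fun r : 'I_n * seq (arrow n) =>
  (\prod_(a <- r.2) w a) *: path_elt k (psi r.1, map phi r.2))) /=.
by case: ifP => // nv; rewrite path_elt_invalid ?scaler0 // valid_map nv.
Qed.

Lemma wmap_arr a : wmap (arr k a) = w a *: arr k (phi a).
Proof. by rewrite /arr wmap_path big_seq1 /= phi_src. Qed.

(** Injectivity of [psi] keeps products of non-composable paths equal to zero. *)
Lemma wmapM x y : wmap (mulQ x y) = mulQ (wmap x) (wmap y).
Proof.
move: x y; apply: pathalg_mul_eq.
- by move=> y c x x'; rewrite mulQ_linear_l linearP.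
- by move=> x c y y'; rewrite mulQ_linear_r linearP.
- by move=> y c x x'; rewrite linearP mulQ_linear_l.
- by move=> x c y y'; rewrite linearP mulQ_linear_r.
move=> v s u t vs ut; rewrite !wmap_path scaleQl scaleQr scalerA !mulQ_path.
rewrite !valid_map vs ut /= pend_map (inj_eq psi_inj).
case: eqP => _; last by rewrite linear0 scaler0.
by rewrite wmap_path big_cat map_cat.
Qed.

Lemma wmap1 : wmap (oneQ k n) = oneQ k n.
Proof.
rewrite /oneQ linear_sum [RHS](reindex_inj psi_inj) /=; apply: eq_bigr => v _.
by rewrite !evertE wmap_path big_nil scale1r.
Qed.

End WeightedMap.

Lemma wmapK (phi phi' : arrow n -> arrow n) (psi psi' : 'I_n -> 'I_n)
    (w w' : arrow n -> k) :
  injective psi -> (forall a, asrc (phi a) = psi (asrc a)) ->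
  (forall a, atgt (phi a) = psi (atgt a)) ->
  injective psi' -> (forall a, asrc (phi' a) = psi' (asrc a)) ->
  (forall a, atgt (phi' a) = psi' (atgt a)) ->
  cancel phi phi' -> cancel psi psi' -> (forall a, w a * w' (phi a) = 1) ->
  cancel (wmap phi psi w) (wmap phi' psi' w').
Proof.
move=> psi_inj phi_s phi_t psi'_inj phi'_s phi'_t phiK psiK ww'.
apply: pathalg_linear_eq => [c x y|//|v s vs]; first by rewrite !linearP.
rewrite wmap_path // linearZ /= wmap_path // scalerA psiK (mapK phiK).
by rewrite big_map -big_split /= big1 ?scale1r // => a _; rewrite ww'.
Qed.

Lemma An_iso_of_relabelling (q p c : 'I_n -> k) (w : arrow n -> k)
    (phi phi' : arrow n -> arrow n) (tau sg : 'I_n -> 'I_n) :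
  cancel tau sg -> cancel sg tau -> cancel phi phi' -> cancel phi' phi ->
  (forall a, asrc (phi a) = tau (asrc a)) ->
  (forall a, atgt (phi a) = tau (atgt a)) ->
  (forall a, w a != 0) -> (forall i, c i != 0) ->
  (forall i, wmap phi tau w (relq q i) = c i *: relq p (tau i)) -> An_iso q p.
Proof.
move=> tauK sgK phiK phi'K phi_s phi_t w_neq0 c_neq0 rel.
have tau_inj := can_inj tauK; have sg_inj := can_inj sgK.
have phi'_s a : asrc (phi' a) = sg (asrc a).
  by rewrite -{2}[a]phi'K phi_s tauK.
have phi'_t a : atgt (phi' a) = sg (atgt a).
  by rewrite -{2}[a]phi'K phi_t tauK.
pose G := wmap phi' sg (fun b => (w (phi' b))^-1).
apply: (@An_iso_of_automorphism q p c tau sg (wmap phi tau w) G) => //.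
- by apply: wmapK => // a; rewrite phiK divff.
- by apply: wmapK => // a; rewrite mulVf.
- exact: wmapM.
- exact: wmap1.
Qed.

Lemma An_iso_rotation (q p alpha : 'I_n -> k) (sg : 'I_n -> 'I_n) :
  injective sg -> (forall i, sg (ordS i) = ordS (sg i)) ->
  (forall i, alpha i != 0) ->
  (forall j, p j = alpha (ord_pred (sg j)) / alpha (sg j) * q (sg j)) ->
  An_iso q p.
Proof.
move=> sg_inj sgS a_neq0 pE; have [tau sgK tauK] := injF_bij sg_inj.
have tauS i : tau (ordS i) = ordS (tau i) by rewrite -{1}[i]tauK -sgS sgK.
have tauP i : tau (ord_pred i) = ord_pred (tau i).
  by rewrite -{2}[i]ord_predK tauS ordSK.
(* Each monomial of a relation contains one unstarred arrow, so rescaling those alone turns [q i]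
   into [alpha (ord_pred i) / alpha i * q i]. *)
pose w (a : arrow n) := if a.2 then 1 else alpha a.1.
pose phi (a : arrow n) : arrow n := (tau a.1, a.2).
have phi_s a : asrc (phi a) = tau (asrc a) by case: a => i []; rewrite /asrc /= ?tauS.
have phi_t a : atgt (phi a) = tau (atgt a) by case: a => i []; rewrite /atgt /= ?tauS.
have tau_inj := can_inj tauK.
apply: (@An_iso_of_relabelling q p alpha w phi (fun a => (sg a.1, a.2)) tau sg) => //.
- by case=> i b; rewrite /phi /= tauK.
- by case=> i b; rewrite /phi /= sgK.
- by case=> i []; rewrite /w /= ?oner_neq0.
move=> i; rewrite !relqE linearB linearZ /= !wmapM // !wmap_arr // /w /phi /=.
rewrite !scaleQl !scaleQr !scale1r scalerBr !scalerA tauP pE tauK; congr (_ - _ *: _).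
by field.
Qed.

Lemma An_iso_reflection (q p alpha : 'I_n -> k) (sg : 'I_n -> 'I_n) :
  injective sg -> (forall i, sg i = ordS (sg (ordS i))) ->
  (forall i, alpha i != 0) -> (forall i, q i != 0) ->
  (forall j, p j = alpha (sg j) / alpha (ord_pred (sg j)) * (q (sg j))^-1) ->
  An_iso q p.
Proof.
move=> sg_inj sgS a_neq0 q_neq0 pE; have [tau sgK tauK] := injF_bij sg_inj.
have tauS i : tau (ordS i) = ord_pred (tau i).
  by rewrite -{1}[i]tauK -[tau i]ord_predK -sgS sgK ordSK.
have tauP i : tau (ord_pred i) = ordS (tau i).
  by rewrite -{2}[i]ord_predK tauS ord_predK.
pose w (a : arrow n) := if a.2 then 1 else alpha a.1.
(* The edge from [i] to [ordS i] lands on the edge between [tau i] and [ord_pred (tau i)], which is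
   indexed by the latter. *)
pose phi (a : arrow n) : arrow n := (ord_pred (tau a.1), ~~ a.2).
have phi_s a : asrc (phi a) = tau (asrc a).
  by case: a => i []; rewrite /asrc /= ?tauS ?ord_predK.
have phi_t a : atgt (phi a) = tau (atgt a).
  by case: a => i []; rewrite /atgt /= ?tauS ?ord_predK.
have tau_inj := can_inj tauK.
(* The reflection swaps the two monomials of a relation; normalising the new leading one inverts
   [q i] and produces this factor. *)
apply: (@An_iso_of_relabelling q p (fun i => - (q i * alpha (ord_pred i))) w phi
  (fun a => (sg (ordS a.1), ~~ a.2)) tau sg) => //.
- by case=> i b; rewrite /phi /= ord_predK tauK negbK.
- by case=> i b; rewrite /phi /= sgK ordSK negbK.
- by case=> i []; rewrite /w /= ?oner_neq0.
- by move=> i; rewrite oppr_eq0 mulf_neq0.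
move=> i; rewrite !relqE linearB linearZ /= !wmapM // !wmap_arr // /w /phi /=.
rewrite !scaleQl !scaleQr !scale1r scalerBr !scalerA tauP ordSK pE tauK.
rewrite addrC -!scaleNr; congr (_ + _ *: _).
by field; rewrite a_neq0 q_neq0.
Qed.

End Relabelling.

(** * Indices as elements of a ring of integers modulo the number of vertices *)

Section IndexArithmetic.
Variable n : nat.

Lemma ordSE (i : 'I_n.+3) : ordS i = i + 1.
Proof. by apply: val_inj => /=; rewrite addn1. Qed.

Lemma ord_predE (i : 'I_n.+3) : ord_pred i = i - 1.
Proof. by apply: (can_inj (@ordSK _)); rewrite ord_predK ordSE subrK. Qed.

Lemma zmodIE (w : 'I_n.+3) z : zmodI w z = z%:~R.
Proof.
(* Euclidean division: the multiple of [n.+3] vanishes in the ring and the remainder is the value of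
   [zmodI]. *)
rewrite [z in RHS](divz_eq z n.+3) intrD intrM -[X in _ * X + _]/(n.+3%:R).
rewrite (@pchar_Zp n.+3) // mulr0 add0r; apply: val_inj => /=.
rewrite -[in RHS](gez0_abs (modz_ge0 z _)) //.
by rewrite -[X in _ = val X]/(_%:R) [RHS](@val_Zp_nat n.+3) // modn_small //
  (zmodI_subproof w).
Qed.

Lemma ord_intr (i : 'I_n.+3) : (i%:Z)%:~R = i.
Proof. by rewrite -pmulrn natr_Zp. Qed.

Lemma rotationE (sg : 'I_n.+3 -> 'I_n.+3) :
  (forall i, sg (ordS i) = ordS (sg i)) -> forall i, sg i = i + sg 0.
Proof.
move=> sgS i; have [m <-] := iter_ordS_transitive 0 i.
by elim: m => [|m IHm] /=; rewrite ?add0r // sgS IHm !ordSE; ring.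
Qed.

Lemma reflectionE (sg : 'I_n.+3 -> 'I_n.+3) :
  (forall i, sg i = ordS (sg (ordS i))) -> forall i, sg i = sg 0 - i.
Proof.
move=> sgS i; have [m <-] := iter_ordS_transitive 0 i.
elim: m => [|m IHm] /=; rewrite ?subr0 // -[LHS](ordSK) -sgS IHm.
by rewrite ord_predE !ordSE; ring.
Qed.

Lemma pchar_ord : (n.+3%:Z)%:~R = 0 :> 'I_n.+3.
Proof. exact: (@pchar_Zp n.+3). Qed.

End IndexArithmetic.

Theorem theorem2p8 (k : closedFieldType) (hk : [pchar k] =i pred0)
  (n : nat) (hn : (3 <= n)%N) (q p : 'I_n -> k)
  (hq : forall i, q i != 0) (hp : forall i, p i != 0) :
  An_iso q p <->
  exists (alpha : 'I_n -> k) (m : 'I_n),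
    (forall i, alpha i != 0) /\
    ((forall i : 'I_n,
        p i = alpha (zmodI i (i%:Z + m%:Z - 1)) / alpha (zmodI i (i%:Z + m%:Z))
              * q (zmodI i (i%:Z + m%:Z)))
     \/
     (forall i : 'I_n,
        p i = alpha (zmodI i (n%:Z - i%:Z - m%:Z)) / alpha (zmodI i (n%:Z - i%:Z - m%:Z - 1))
              * (q (zmodI i (n%:Z - i%:Z - m%:Z)))^-1)).
Proof.
(* Ordinals below [n.+3] carry the ring structure used for the index computations. *)
case: n => [|[|[|n]]] // in hn q p hq hp *.
split=> [[f [f_compat [fD [fZ [fM [f1 [_ f_surj]]]]]]]|].
  have [sg sgE] := vcoef_pullback hn fD fZ fM f1.
  have [alpha [a_neq0]] := iso_parameters hn f_compat fD fZ fM f_surj sgE hq.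
  case=> -[sgS pE]; exists alpha.
    exists (sg 0); split=> //; left=> i.
    by rewrite !zmodIE !intrD !ord_intr pE ord_predE (rotationE sgS i).
  (* Here [sg i = sg 0 - i], to be matched with [- i - m]. *)
  exists (- sg 0); split=> //; right=> i.
  rewrite !zmodIE !intrB !ord_intr pchar_ord add0r pE ord_predE (reflectionE sgS i).
  by rewrite opprK [- i + _]addrC.
case=> alpha [m [a_neq0 [pE|pE]]].
  apply: (An_iso_rotation (alpha := alpha) (sg := fun i => i + m)) => //.
  - exact: addIr.
  - by move=> i; rewrite !ordSE; ring.
  - by move=> i; rewrite pE !zmodIE !intrD !ord_intr ord_predE.
apply: (An_iso_reflection (alpha := alpha) (sg := fun i => - i - m)) => //.
- by move=> i j /addIr/oppr_inj.
- by move=> i; rewrite !ordSE; ring.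
- by move=> i; rewrite pE !zmodIE !intrB !ord_intr pchar_ord add0r ord_predE.
Qed.
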